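(* Let $(\mathbb T,d)$ be a locally compact, separable metric space. Let $G\subset\mathbb T$ be an open subset with compact closure. If $f_n$ hypi-converges to $f$ in $\ell^\infty_{\mathrm{loc}}(\mathbb T)$ and if $f$ is continuous on the boundary of $G$ (i.e. continuous, as a function on $\mathbb T$, at every boundary point of $G$), then $\inf f_n(G)\to\inf f(G)$ and $\sup f_n(G)\to\sup f(G)$ as $n\to\infty$. If $G=\mathbb T$ is compact, then the boundary of $G$ in $\mathbb T$ is empty, and hence the conclusions hold true without imposing any conditions on $f$.
   Context: $\ell^\infty_{\mathrm{loc}}(\mathbb T)$ is the set of functions $f:\mathbb T\to\mathbb R$ that are bounded on compact subsets of $\mathbb T$. For such $f$, $f_\wedge(x)=\sup_{\varepsilon>0}\inf\{f(x'):d(x',x)<\varepsilon\}$ and $f_\vee(x)=\inf_{\varepsilon>0}\sup\{f(x'):d(x',x)<\varepsilon\}$. A sequence $f_n\in\ell^\infty_{\mathrm{loc}}(\mathbb T)$ hypi-converges to $f\in\ell^\infty_{\mathrm{loc}}(\mathbb T)$ if $f_n$ epi-converges to $f_\wedge$ and hypo-converges to $f_\vee$, i.e. if for every $x\in\mathbb T$: (a) for all sequences $x_n\to x$, $f_\wedge(x)\le\liminf_nf_n(x_n)$ and $\limsup_nf_n(x_n)\le f_\vee(x)$; (b) there exists a sequence $x_n\to x$ with $\limsup_nf_n(x_n)\le f_\wedge(x)$; (c) there exists a sequence $x_n\to x$ with $\liminf_nf_n(x_n)\ge f_\vee(x)$. $f(G)$ denotes the image of $G$ under $f$. *)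

(* Defs.v *)
From HB Require Import structures.
From mathcomp Require Import all_boot all_order all_algebra.
From mathcomp Require Import all_classical all_reals all_analysis.
Set Implicit Arguments.
Unset Strict Implicit.
Unset Printing Implicit Defensive.
Import Order.TTheory GRing.Theory Num.Theory.
Import numFieldNormedType.Exports.
Local Open Scope classical_set_scope.
Local Open Scope ring_scope.

Definition separable (T : topologicalType) : Prop :=
  exists2 D : set T, countable D & dense D.

Definition boundary (T : topologicalType) (A : set T) : set T :=
  closure A `\` A°.

Definition linfty_loc (R : realType) (T : metricType R) : set (T -> R) :=
  [set f | forall K : set T, compact K -> [bounded f x | x in K]].

(* The hulls take values in [\bar R], so that they are genuine suprema and
   infima for every f; they are finite when f is locally bounded. *)
Definition lsc_hull (R : realType) (T : metricType R) (f : T -> R) (x : T)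
    : \bar R :=
  ereal_sup [set ereal_inf [set (f x')%:E | x' in [set x' | mdist x' x < e]]
            | e in [set e : R | 0 < e]].

Definition usc_hull (R : realType) (T : metricType R) (f : T -> R) (x : T)
    : \bar R :=
  ereal_inf [set ereal_sup [set (f x')%:E | x' in [set x' | mdist x' x < e]]
            | e in [set e : R | 0 < e]].

Definition epi_converges (R : realType) (T : metricType R)
    (f_ : nat -> T -> R) (g : T -> \bar R) : Prop :=
  forall x : T,
    (forall x_ : nat -> T, x_ @ \oo --> x ->
       (g x <= limn_einf (fun n => (f_ n (x_ n))%:E))%E) /\
    (exists2 x_ : nat -> T, x_ @ \oo --> x &
       (limn_esup (fun n => (f_ n (x_ n))%:E) <= g x)%E).

Definition hypo_converges (R : realType) (T : metricType R)
    (f_ : nat -> T -> R) (g : T -> \bar R) : Prop :=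
  forall x : T,
    (forall x_ : nat -> T, x_ @ \oo --> x ->
       (limn_esup (fun n => (f_ n (x_ n))%:E) <= g x)%E) /\
    (exists2 x_ : nat -> T, x_ @ \oo --> x &
       (g x <= limn_einf (fun n => (f_ n (x_ n))%:E))%E).

Definition hypi_converges (R : realType) (T : metricType R)
    (f_ : nat -> T -> R) (f : T -> R) : Prop :=
  epi_converges f_ (lsc_hull f) /\ hypo_converges f_ (usc_hull f).

(* Extended-real infimum and supremum of the image h(G): the convention for
   empty G is inf = +oo, sup = -oo, and the value is the usual real one when
   G is nonempty and h is bounded on G. *)
Definition inf_on (R : realType) (T : Type) (h : T -> R) (G : set T)
    : \bar R := ereal_inf (EFin @` (h @` G)).

Definition sup_on (R : realType) (T : Type) (h : T -> R) (G : set T)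
    : \bar R := ereal_sup (EFin @` (h @` G)).

(* Main.v *)
(* The supremum case follows from the infimum case applied to -f_n and -f.
   For the infimum, an upper bound comes from a recovery sequence at a point of
   the open set G.  For the lower bound, r < inf f(G) implies r < f_wedge on the
   closure of G: on G because G is open, on the boundary because f is continuous
   there.  The liminf inequality then bounds f_n from below by r on a
   neighbourhood of each point of the closure of G, for all large n, and
   compactness makes this uniform. *)

Require Import Defs.
From HB Require Import structures.
From mathcomp Require Import all_boot all_order all_algebra.
From mathcomp Require Import all_classical all_reals all_analysis.
Import Order.TTheory GRing.Theory Num.Theory.
Import numFieldNormedType.Exports.
Local Open Scope classical_set_scope.
Local Open Scope ring_scope.

(** Turns a liminf inequality known along sequences into a bound on a whole neighbourhood. If it
    fails, there are bad pairs with index at least [k] and point within [1/(k+1)] of [x], and these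
    are threaded into one sequence tending to [x]. *)
Lemma near_nbhs_seq (R : realType) (T : pseudoMetricType R) (x : T)
    (P : nat -> T -> Prop) :
  (forall x_ : nat -> T, x_ @ \oo --> x -> \forall n \near \oo, P n (x_ n)) ->
  \forall y \near x & n \near \oo, P n y.
Proof.
move=> Pseq; apply: contrapT => nP.
have : forall k : nat, exists p : nat * T,
    [/\ (k <= p.1)%N, ball x k.+1%:R^-1 p.2 & ~ P p.1 p.2].
  move=> k; apply: contrapT => nk; apply: nP.
  exists (ball x k.+1%:R^-1, [set n | (k <= n)%N]) => /=.
    by split; [exact: nbhsx_ballx|exact: nbhs_infty_ge].
  move=> [y n] /= [xy kn]; apply: contrapT => nPny.
  by apply: nk; exists (n, y).
move=> /choice[p pP].
(* As k <= (p k).1, each n equals (p k).1 for finitely many k only, so any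
   choice of k gives a sequence converging to x. *)
pose x_ n := if pselect (exists k, (p k).1 = n) is left e
             then (p (projT1 (cid e))).2 else x.
have /Pseq[N _ PN] : x_ @ \oo --> x.
  apply/cvg_ballP => e e0.
  have [M _ MP] := @near_infty_natSinv_lt R (PosNum e0).
  (* Beyond this maximum, [n = (p k).1] forces [M <= k], so the point chosen at [n] is within [e] of
     [x]. *)
  exists (\max_(k < M) (p k).1).+1 => // n /= Mn.
  rewrite /x_; case: pselect => [ex|_]; last exact: ballxx.
  case: (cid ex) => k /= kn.
  apply: (le_ball (ltW (MP k _))) => /=; last by case: (pP k).
  rewrite leqNgt; apply/negP => kM.
  by move: Mn; rewrite ltnNge -kn (leq_bigmax (Ordinal kM)).
(* The [k] selected at index [(p N).1] may differ from [N], but every such [k] contradicts [P]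
   there. *)
have [Nn _ _] := pP N.
have := PN _ Nn; rewrite /x_; case: pselect => [ex|nex].
  by case: (cid ex) => k /= <-; case: (pP k).
by exfalso; apply: nex; exists N.
Qed.

(** Real thresholds suffice even for an infinite [l], as for the infimum over an empty set: one
    hypothesis is then vacuous and the other is divergence. *)
Lemma cvge_real_bounds (R : realType) (u : nat -> \bar R) (l : \bar R) :
  (forall r : R, (r%:E < l)%E -> \forall n \near \oo, (r%:E <= u n)%E) ->
  (forall r : R, (l < r%:E)%E -> \forall n \near \oo, (u n <= r%:E)%E) ->
  u @ \oo --> l.
Proof.
case: l => [l||] ul lu.
- move=> A [e /= e0 leA].
  (* Halving [e] makes up for the non-strict bounds, since balls are open. *)
  have l1 : \forall n \near \oo, ((l - e / 2)%:E <= u n)%E.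
    by apply: ul; rewrite lte_fin ltrBlDr ltrDl divr_gt0.
  have l2 : \forall n \near \oo, (u n <= (l + e / 2)%:E)%E.
    by apply: lu; rewrite lte_fin ltrDl divr_gt0.
  apply: filterS2 l1 l2 => n; rewrite /preimage /=.
  case: (u n) => // v; rewrite !lee_fin => lv vl.
  apply: leA => /=; rewrite ltr_distlC; apply/andP; split.
    by apply: lt_le_trans lv; rewrite ltrD2l ltrN2 gtr_pMr// invf_lt1// ltr1n.
  by apply: le_lt_trans vl _; rewrite ltrD2l gtr_pMr// invf_lt1// ltr1n.
- by apply/cvgeyPge => r; exact/ul/ltry.
- by apply/cvgeNyPle => r; exact/lu/ltNyr.
Qed.

Lemma near_lt_limn_einf (R : realType) (u : nat -> \bar R) (a : \bar R) :
  (a < limn_einf u)%E -> \forall n \near \oo, (a < u n)%E.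
Proof.
rewrite /limn_einf /limn_esup lteNr limf_esupE.
move=> /ereal_inf_ltP[_ [V V1 <-]] Va.
apply: filterS V1 => n Vn.
rewrite -lteN2; apply: le_lt_trans Va; apply: ereal_sup_ubound.
by exists n.
Qed.

Lemma near_limn_esup_lt (R : realType) (u : nat -> \bar R) (a : \bar R) :
  (limn_esup u < a)%E -> \forall n \near \oo, (u n < a)%E.
Proof.
rewrite /limn_esup limf_esupE => /ereal_inf_ltP[_ [V V1 <-]] Va.
apply: filterS V1 => n Vn.
by apply: le_lt_trans Va; apply: ereal_sup_ubound; exists n.
Qed.

Lemma inf_on_le (R : realType) (T : Type) (h : T -> R) (G : set T) (x : T) :
  G x -> (inf_on h G <= (h x)%:E)%E.
Proof. by move=> Gx; apply: ereal_inf_lbound; exists (h x) => //; exists x. Qed.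

Lemma lsc_hull_ge (R : realType) (T : metricType R) (f : T -> R) (x : T)
    (a : \bar R) :
  (\forall y \near x, (a <= (f y)%:E)%E) -> (a <= lsc_hull f x)%E.
Proof.
move=> /nbhs_ballP[e /= e0 xe]; apply: le_ereal_sup_tmp.
exists (ereal_inf [set (f x')%:E | x' in [set x' | mdist x' x < e]]).
  by exists e.
apply/ereal_infP => _ [y /= yx <-]; apply: xe.
by rewrite ballEmdist /= metric_sym.
Qed.

Lemma lsc_hull_le (R : realType) (T : metricType R) (f : T -> R) (x : T) :
  (lsc_hull f x <= (f x)%:E)%E.
Proof.
apply/ereal_supP => _ [e /= e0 <-]; apply: ereal_inf_lbound.
by exists x => //=; rewrite mdistxx.
Qed.

Lemma lsc_hull_gt_inf_on (R : realType) (T : metricType R) (f : T -> R)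
    (G : set T) (r : R) (x : T) :
  open G -> (forall x : T, boundary G x -> {for x, continuous f}) ->
  (r%:E < inf_on f G)%E -> closure G x -> (r%:E < lsc_hull f x)%E.
Proof.
move=> oG fcont rG clGx; have [Gx|nGx] := pselect (G x).
  apply: lt_le_trans rG _; apply: lsc_hull_ge.
  by apply: filterS (open_nbhs_nbhs (conj oG Gx)) => y; exact: inf_on_le.
have fx : {for x, continuous f}.
  by apply: fcont; split => //; rewrite ((interior_id G).1 oG).
have rfx : r < f x.
  (* Were [f x] below the infimum, continuity would keep [f] below it near [x], hence at some point
     of [G]. *)
  rewrite -lte_fin; apply: (lt_le_trans rG); rewrite leNgt; apply/negP => fxG.
  have /clGx[y [Gy]] : \forall y \near x, ((f y)%:E < inf_on f G)%E.
    have : (EFin \o f) @ x --> (f x)%:E by apply: cvg_EFin => //; exact: nearW.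
    move=> /(_ [set z | (z < inf_on f G)%E]); apply.
    by apply: open_nbhs_nbhs; split=> //; exact: open_ereal_lt_ereal.
  by rewrite ltNge inf_on_le.
(* A local lower bound passes to the hull only non-strictly; the midpoint keeps the inequality with
   [r] strict. *)
apply: (@lt_le_trans _ _ ((r + f x) / 2)%:E).
  by rewrite lte_fin midf_lt.
apply: lsc_hull_ge.
have : \forall y \near x, (r + f x) / 2 < f y.
  by apply: cvgr_gt fx _ _; rewrite midf_lt.
by apply: filterS => y /ltW; rewrite lee_fin.
Qed.

Lemma epi_converges_cvg_inf_on (R : realType) (T : metricType R)
    (f_ : nat -> T -> R) (f : T -> R) (G : set T) :
  epi_converges f_ (lsc_hull f) -> open G -> compact (closure G) ->
  (forall x : T, boundary G x -> {for x, continuous f}) ->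
  inf_on (f_ n) G @[n --> \oo] --> inf_on f G.
Proof.
move=> epi oG cG fcont; apply: cvge_real_bounds => r rG.
  have cov (x : T) : closure G x ->
      \forall y \near x & n \near \oo, (r%:E < (f_ n y)%:E)%E.
    move=> clGx; apply: near_nbhs_seq => x_ x_x.
    apply: near_lt_limn_einf; apply: lt_le_trans ((epi x).1 _ x_x).
    exact: lsc_hull_gt_inf_on rG clGx.
  have rG_ : \forall n \near \oo,
      closure G `<=` [set y | (r%:E < (f_ n y)%:E)%E].
    (* The near-covering form of compactness merges the local thresholds in [n] into one. *)
    exact: (compact_near_coveringP _).1 cG _ _ _ _ cov.
  apply: filterS rG_ => n Gr; apply/ereal_infP => _ [_ [y Gy <-] <-].
  exact/ltW/Gr/subset_closure.
move: rG => /ereal_inf_ltP[_ [_ [x Gx <-] <-] fxr].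
have [x_ x_x ltx] := (epi x).2.
(* The limsup along the recovery sequence is at most the hull at [x], hence at most [f x], which is
   below [r]. *)
have := le_lt_trans ltx (le_lt_trans (lsc_hull_le _ _ f x) fxr).
move/near_limn_esup_lt.
have : \forall n \near \oo, G (x_ n).
  by apply: x_x; apply: open_nbhs_nbhs.
apply: filterS2 => n Gxn /ltW; apply: le_trans; exact: inf_on_le.
Qed.

Lemma inf_onN (R : realType) (T : Type) (h : T -> R) (G : set T) :
  inf_on (\- h) G = (- sup_on h G)%E.
Proof. by rewrite /inf_on /sup_on -ereal_infN !image_comp. Qed.

Lemma lsc_hullN (R : realType) (T : metricType R) (f : T -> R) (x : T) :
  lsc_hull (\- f) x = (- usc_hull f x)%E.
Proof.
rewrite /lsc_hull /usc_hull -ereal_supN image_comp; congr ereal_sup.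
by apply: eq_imagel => e _ /=; rewrite -ereal_infN image_comp.
Qed.

(** Negation exchanges the hulls, and liminf with limsup, so each clause goes to its counterpart
    along the same sequences. *)
Lemma hypo_convergesN (R : realType) (T : metricType R)
    (f_ : nat -> T -> R) (f : T -> R) :
  hypo_converges f_ (usc_hull f) ->
  epi_converges (fun n => \- f_ n) (lsc_hull (\- f)).
Proof.
move=> hypo x; rewrite lsc_hullN; split=> [x_ x_x|].
  rewrite (_ : (fun _ => _) = -%E \o (fun n => (f_ n (x_ n))%:E)) //.
  by rewrite limn_einfN leeN2; exact: (hypo x).1.
have [x_ x_x le_x] := (hypo x).2.
exists x_ => //.
rewrite (_ : (fun _ => _) = -%E \o (fun n => (f_ n (x_ n))%:E)) //.
by rewrite limn_esupN leeN2.
Qed.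

Theorem proposition2p3 (R : realType) (T : metricType R)
    (lcT : locally_compact [set: T]) (sepT : separable T)
    (f_ : nat -> T -> R) (f : T -> R)
    (f_loc : forall n, linfty_loc (f_ n)) (floc : linfty_loc f)
    (hypi : hypi_converges f_ f) :
  (forall G : set T, open G -> compact (closure G) ->
     (forall x : T, boundary G x -> {for x, continuous f}) ->
     (inf_on (f_ n) G @[n --> \oo] --> inf_on f G) /\
     (sup_on (f_ n) G @[n --> \oo] --> sup_on f G)) /\
  (compact [set: T] ->
     boundary [set: T] = set0 /\
     (inf_on (f_ n) [set: T] @[n --> \oo] --> inf_on f [set: T]) /\
     (sup_on (f_ n) [set: T] @[n --> \oo] --> sup_on f [set: T])).
Proof.
have cvgG (G : set T) : open G -> compact (closure G) ->
    (forall x : T, boundary G x -> {for x, continuous f}) ->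
    (inf_on (f_ n) G @[n --> \oo] --> inf_on f G) /\
    (sup_on (f_ n) G @[n --> \oo] --> sup_on f G).
  move=> oG cG fcont; case: hypi => epi hypo.
  split; first exact: epi_converges_cvg_inf_on.
  apply/cvgeNP; rewrite -inf_onN; under eq_fun do rewrite -inf_onN.
  apply: epi_converges_cvg_inf_on oG cG _; first exact: hypo_convergesN.
  move=> x Gx.
  exact/continuousN/fcont.
have boundaryT : boundary [set: T] = set0.
  by rewrite /boundary interiorT setDT.
split=> // cT; split=> //; apply: cvgG; first exact: openT.
  by rewrite closureT.
by rewrite boundaryT.
Qed.
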